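(* The following Szegő type recurrence relations hold: $$RB(z)=\bar{\mathcal A}(z^{-1}),\quad \mathcal B(z)R=\bar A(z^{-1}),\quad \mathcal R\,\bar{\mathcal A}(z)=B(z^{-1}),\quad \bar A(z)\,\mathcal R=\mathcal B(z^{-1}),$$ $$S\,\bar{\mathcal A}(z^{-1})=zB(z),\quad \bar A(z^{-1})S=z\,\mathcal B(z),\quad \mathcal S\,B(z^{-1})=z\,\bar{\mathcal A}(z),\quad \mathcal B(z^{-1})\,\mathcal S=z\,\bar A(z).$$
   Context: Let $p,q\in\mathbb N$ and let $\mu$ be a $q\times p$ matrix of complex Borel measures with infinite support on the unit circle $\mathbb T=\{|z|=1\}$. Rows and columns of semi-infinite matrices are indexed from $0$. For $r\in\mathbb N$, $Z_{[r]}(z)$ is the $\infty\times r$ matrix obtained by stacking the $r\times r$ blocks $I_r, z^{-1}I_r, zI_r, z^{-2}I_r, z^2I_r,\dots$ (block number $2N$ is $z^NI_r$, block number $2N+1$ is $z^{-N-1}I_r$). The left and right moment matrices are $$M=\oint_{\mathbb T}Z_{[q]}(z)\,\mathrm d\mu(z)\,Z_{[p]}^\top(z^{-1}),\qquad \mathcal M=\oint_{\mathbb T}Z_{[q]}(z^{-1})\,\mathrm d\mu(z)\,Z_{[p]}^\top(z).$$ It is assumed that they have Gauss--Borel factorizations $M=L^{-1}\bar U^{-1}$ and $\mathcal M=\bar{\mathcal L}^{-1}\mathcal U^{-1}$, with $L,\mathcal L$ lower triangular and $U,\mathcal U$ upper triangular semi-infinite matrices with nonzero diagonal entries (bar = entrywise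 complex conjugation). Put $$B(z)=LZ_{[q]}(z),\quad A(z)=Z_{[p]}^\top(z)U,\quad \mathcal A(z)=\mathcal LZ_{[q]}(z),\quad \mathcal B(z)=Z_{[p]}^\top(z)\,\mathcal U .$$ For a Laurent polynomial with matrix coefficients $P(z)=\sum P_kz^k$, $\bar P(z)=\sum\bar P_kz^k$. For $r\in\mathbb N$, with $r\times r$ blocks indexed from $0$: $\eta_{[r]}$ is the semi-infinite block permutation matrix fixing block $0$ and swapping blocks $2k+1\leftrightarrow 2k+2$ ($k\ge0$); $\nu_{[r]}$ is the semi-infinite block permutation matrix swapping blocks $2k\leftrightarrow2k+1$ ($k\ge0$). One has $\eta_{[q]}M=\mathcal M\eta_{[p]}$, $M\eta_{[p]}=\eta_{[q]}\mathcal M$, $\nu_{[q]}M=\mathcal M\nu_{[p]}$, $M\nu_{[p]}=\nu_{[q]}\mathcal M$, and the Szegő recurrence matrices are $$R=\bar{\mathcal L}\eta_{[q]}L^{-1}=\mathcal U^{-1}\eta_{[p]}\bar U,\quad \mathcal R=L\eta_{[q]}\bar{\mathcal L}^{-1}=\bar U^{-1}\eta_{[p]}\mathcal U,$$ $$S=L\nu_{[q]}\bar{\mathcal L}^{-1}=\bar U^{-1}\nu_{[p]}\mathcal U,\quad \mathcal S=\bar{\mathcal L}\nu_{[q]}L^{-1}=\mathcal U^{-1}\nu_{[p]}\bar U.$$ *)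

(* Defs.v *)
From HB Require Import structures.
From mathcomp Require Import all_boot all_order all_algebra.
From mathcomp Require Import complex.
From mathcomp Require Import all_classical all_reals all_analysis.

Set Implicit Arguments.
Unset Strict Implicit.
Unset Printing Implicit Defensive.

Import Order.TTheory GRing.Theory Num.Theory.
Import numFieldNormedType.Exports.

Local Open Scope classical_set_scope.
Local Open Scope ring_scope.

Definition circle (R : realType) : Type := {z : R[i] | `|z| == 1}.

HB.instance Definition _ (R : realType) := SubChoice.on (circle R).
HB.instance Definition _ (R : realType) :=
  isPointed.Build (circle R) (exist (fun z : R[i] => `|z| == 1) 1
    (introT eqP (normr1 R[i]))).

Definition circle_open (R : realType) : set (set (circle R)) :=
  @open (initial_topology (val : circle R -> (R[i])^o)).

Definition borel_circle (R : realType) := g_sigma_algebraType (@circle_open R).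

(* The charges of the library are finite, so a pair of charges (the real and
   the imaginary part) is exactly a complex measure. *)
Record complex_measure d (T : measurableType d) (R : realType) :=
  ComplexMeasure {
    re_measure : {charge set T -> \bar R};
    im_measure : {charge set T -> \bar R} }.

Definition measure_val d (T : measurableType d) (R : realType)
    (mu : complex_measure T R) (A : set T) : R[i] :=
  (fine (re_measure mu A) +i* fine (im_measure mu A))%C.

Section charge_integral.
Context d (T : measurableType d) (R : realType).
Variable nu : {charge set T -> \bar R}.

Definition hahn_pos : set T := projT1 (cid (Hahn_decomposition nu)).

Definition hahn_neg : set T :=
  projT1 (cid (projT2 (cid (Hahn_decomposition nu)))).

Lemma hahn_posneg : hahn_decomposition nu hahn_pos hahn_neg.
Proof. exact: projT2 (cid (projT2 (cid (Hahn_decomposition nu)))). Qed.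

Definition charge_integral (f : T -> R) : R :=
  \int[jordan_pos hahn_posneg]_(t in setT) f t -
  \int[jordan_neg hahn_posneg]_(t in setT) f t.

End charge_integral.

Definition complex_integral d (T : measurableType d) (R : realType)
    (mu : complex_measure T R) (f : T -> R[i]) : R[i] :=
  ((charge_integral (re_measure mu) (fun t => complex.Re (f t)) -
    charge_integral (im_measure mu) (fun t => complex.Im (f t))) +i*
   (charge_integral (re_measure mu) (fun t => complex.Im (f t)) +
    charge_integral (im_measure mu) (fun t => complex.Re (f t))))%C.

(* An open set has total variation 0 iff [mu] vanishes on all its measurable
   subsets, so this is the support of the total variation of [mu]. *)
Definition measure_support (R : realType)
    (mu : complex_measure (borel_circle R) R) : set (circle R) :=
  [set t | forall U : set (borel_circle R), circle_open U -> U t ->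
    exists A : set (borel_circle R),
      [/\ measurable A, A `<=` U & measure_val mu A != 0]].

Section Imatrix.
Context {C : numClosedFieldType}.
Implicit Types I J K : choiceType.

Definition imatrix (I J : Type) := I -> J -> C.

(* [\sum_(k \in setT)] is the sum over the finite support of the summand: all
   the products formed below only involve such sums (and it is the ordinary
   finite sum when [K] is finite). *)
Definition imul (I J : Type) K (A : imatrix I K) (B : imatrix K J) :
  imatrix I J := fun i j => \sum_(k \in [set: K]) A i k * B k j.

Definition itr (I J : Type) (A : imatrix I J) : imatrix J I := fun j i => A i j.

Definition iscale (I J : Type) (z : C) (A : imatrix I J) : imatrix I J :=
  fun i j => z * A i j.

Definition iconj (I J : Type) (A : imatrix I J) : imatrix I J :=
  fun i j => (A i j)^*.

Definition iid : imatrix nat nat := fun i j => (i == j)%:R.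

Definition lower_tri (A : imatrix nat nat) :=
  forall i j, (i < j)%N -> A i j = 0.

Definition upper_tri (A : imatrix nat nat) :=
  forall i j, (j < i)%N -> A i j = 0.

Definition nz_diag (A : imatrix nat nat) := forall i, A i i != 0.

Definition itrunc n (A : imatrix nat nat) : 'M[C]_n := \matrix_(i, j) A i j.

(* The inverse of a triangular matrix with nonzero diagonal: its leading
   principal submatrices are the inverses of those of the matrix; see
   [itriinv_lower] and [itriinv_upper]. *)
Definition itriinv (A : imatrix nat nat) : imatrix nat nat :=
  fun i j => invmx (itrunc (maxn i j).+1 A) (inord i) (inord j).

(* [P k] is the coefficient of z^k in P(z); when there are infinitely many rows
   or columns, each entry is a Laurent polynomial, but the degrees need not be
   bounded. *)
Definition laurent (I J : Type) := int -> imatrix I J.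

Definition lmul_mx (I J : Type) K (A : imatrix I K) (P : laurent K J) :
  laurent I J := fun k => imul A (P k).

Definition lmulr_mx (I J : Type) K (P : laurent I K) (A : imatrix K J) :
  laurent I J := fun k => imul (P k) A.

Definition ltr (I J : Type) (P : laurent I J) : laurent J I :=
  fun k => itr (P k).

Definition lbar (I J : Type) (P : laurent I J) : laurent I J :=
  fun k => iconj (P k).

Definition leval (I J : Type) (P : laurent I J) (z : C) : imatrix I J :=
  fun i j => \sum_(k \in [set: int]) P k i j * z ^ k.

Definition block_exp (n : nat) : int :=
  if odd n then - (n./2.+1)%:Z else (n./2)%:Z.

Definition Zmx (r : nat) : laurent nat 'I_r :=
  fun k i a => ((k == block_exp (i %/ r)) && (i %% r == a)%N)%:R.

Arguments Zmx r _ _ _ : clear implicits.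

Definition block_perm (r : nat) (s : nat -> nat) : imatrix nat nat :=
  fun i j => ((s (i %/ r) == j %/ r) && (i %% r == j %% r))%N%:R.

Definition eta_perm (n : nat) : nat :=
  if n == 0%N then 0%N else if odd n then n.+1 else n.-1.

Definition nu_perm (n : nat) : nat := if odd n then n.-1 else n.+1.

Definition eta_mx (r : nat) := block_perm r eta_perm.

Definition nu_mx (r : nat) := block_perm r nu_perm.

Lemma imulE (I J : Type) (A : imatrix I nat) (B : imatrix nat J) i j n :
  (forall k, (n <= k)%N -> A i k * B k j = 0) ->
  imul A B i j = \sum_(k < n) A i k * B k j.
Proof.
move=> AB0; rewrite /imul (fsbigE (iota 0 n)) ?iota_uniq//.
  rewrite -(big_mkord xpredT (fun k => A i k * B k j)) /index_iota subn0.
  by apply: eq_bigl => k; rewrite in_setT.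
by move=> k _; rewrite mem_iota/= add0n -leqNgt; exact: AB0.
Qed.

Lemma leval_Zmx r z i (a : 'I_r) :
  leval (Zmx r) z i a =
  if (i %% r == a)%N then z ^ block_exp (i %/ r) else 0.
Proof.
rewrite /leval (fsbigE [:: block_exp (i %/ r)])//.
  rewrite big_mkcond big_seq1 in_setT /Zmx eqxx andTb.
  by case: (i %% r == a)%N; rewrite ?mul1r ?mul0r.
by move=> k _; rewrite mem_seq1 /Zmx => /negPf->; rewrite mul0r.
Qed.

Lemma block_exp_even n : block_exp n.*2 = n%:Z.
Proof. by rewrite /block_exp odd_double doubleK. Qed.

Lemma block_exp_odd n : block_exp n.*2.+1 = - n%:Z - 1.
Proof.
by rewrite /block_exp/= odd_double/= uphalf_double -addn1 PoszD opprD.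
Qed.

Definition iinverse (A B : imatrix nat nat) := imul A B = iid /\ imul B A = iid.

Lemma itriinv_tr A : itriinv (itr A) = itr (itriinv A).
Proof.
apply/funext => i; apply/funext => j; rewrite /itriinv /itr maxnC.
set n := (maxn j i).+1.
have -> : itrunc n (fun j0 i0 => A i0 j0) = (itrunc n A)^T.
  by apply/matrixP => a b; rewrite !mxE.
by rewrite -trmx_inv mxE.
Qed.

Section lower.
Variable L : imatrix nat nat.
Hypotheses (Llow : lower_tri L) (Lnz : nz_diag L).

Lemma itrunc_unit n : itrunc n L \in unitmx.
Proof.
rewrite unitmxE det_trig; last first.
  by apply/is_trig_mxP => i j ij; rewrite mxE Llow.
by rewrite unitfE; apply/prodf_neq0 => i _; rewrite mxE.
Qed.

Lemma itrunc_inv_lower m n (i : 'I_m) (j : 'I_n) : (m <= n)%N ->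
  forall i' : 'I_n, i' = i :> nat ->
  invmx (itrunc n L) i' j =
  if insub (val j) is Some j' then invmx (itrunc m L) i j' else 0.
Proof.
move=> mn i' i'i; pose P : 'M[C]_(m, n) := \matrix_(a, b) (a == b :> nat)%:R.
have E : P *m itrunc n L = itrunc m L *m P.
  apply/matrixP => a b; rewrite !mxE.
  rewrite (bigD1 (widen_ord mn a))//= big1 ?addr0; last first.
    move=> k ka; rewrite !mxE; case: eqP => [ak|]; rewrite ?mul0r//.
    by case/negP: ka; apply/eqP/val_inj.
  rewrite !mxE eqxx mul1r; have [bm|bm] := ltnP b m.
    rewrite (bigD1 (Ordinal bm))//= big1 ?addr0; last first.
      move=> k kb; rewrite !mxE; case: eqP => [ak|]; rewrite ?mulr0//.
      by case/negP: kb; apply/eqP/val_inj.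
    by rewrite !mxE/= eqxx mulr1.
  rewrite Llow ?(leq_trans (ltn_ord a) bm)// big1// => k _; rewrite !mxE.
  by rewrite ltn_eqF ?mulr0// (leq_trans (ltn_ord k) bm).
have E' : invmx (itrunc m L) *m P = P *m invmx (itrunc n L).
  rewrite -[LHS](mulmxK (itrunc_unit n)) -(mulmxA (invmx _)) E mulKmx//.
  exact: itrunc_unit.
have -> : invmx (itrunc n L) i' j = (P *m invmx (itrunc n L)) i j.
  rewrite mxE (bigD1 i')//= big1 ?addr0 => [|k ki].
    by rewrite mxE i'i eqxx mul1r.
  rewrite mxE; case: eqP => [ik|]; rewrite ?mul0r//.
  by case/negP: ki; apply/eqP/val_inj; rewrite /= i'i.
rewrite -E' mxE; case: insubP => [j' jm jj'|jm].
  rewrite (bigD1 j')//= big1 ?addr0 ?mxE ?jj' ?eqxx ?mulr1// => k kj.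
  rewrite !mxE; case: eqP => [kj'|]; rewrite ?mulr0//.
  by case/negP: kj; apply/eqP/val_inj; rewrite jj'.
rewrite -leqNgt in jm; rewrite big1// => k _; rewrite !mxE.
by rewrite ltn_eqF ?mulr0// (leq_trans (ltn_ord k) jm).
Qed.

Lemma itriinv_trunc n : itrunc n (itriinv L) = invmx (itrunc n L).
Proof.
apply/matrixP => i j; rewrite mxE /itriinv; set m := (maxn i j).+1.
have im : (i < m)%N by rewrite ltnS leq_maxl.
have jm : (j < m)%N by rewrite ltnS leq_maxr.
have mn : (m <= n)%N by rewrite gtn_max !ltn_ord.
rewrite (@itrunc_inv_lower m n (inord i) j mn i) ?inordK//.
case: insubP => [j' _ jj'|]; last by rewrite jm.
by congr (invmx _ _ _); apply: val_inj; rewrite /= inordK.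
Qed.

Lemma itriinv_low : lower_tri (itriinv L).
Proof.
move=> i j ij; rewrite /itriinv; set m := (maxn i j).+1.
have im : (i < m)%N by rewrite ltnS leq_maxl.
have jm : (j < m)%N by rewrite ltnS leq_maxr.
rewrite (@itrunc_inv_lower i.+1 m ord_max (inord j)) ?inordK//.
case: insubP => [j' _ ji|//]; have: (val j' < i.+1)%N by exact: ltn_ord.
by rewrite ji /= inordK// => ji'; rewrite ltnNge -ltnS ji' in ij.
Qed.

End lower.

Lemma imul_trunc_lower (A B : imatrix nat nat) n : lower_tri A ->
  itrunc n (imul A B) = itrunc n A *m itrunc n B.
Proof.
move=> Alow; apply/matrixP => i j; rewrite !mxE (imulE (n := n)) => [|k nk].
  by apply: eq_bigr => k _; rewrite !mxE.
by rewrite Alow ?mul0r// (leq_trans (ltn_ord i) nk).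
Qed.

Lemma itrunc_inj (A B : imatrix nat nat) :
  (forall n, itrunc n A = itrunc n B) -> A = B.
Proof.
move=> AB; apply/funext => i; apply/funext => j.
have /matrixP/(_ (inord i) (inord j)) := AB (maxn i j).+1.
by rewrite !mxE !inordK// ltnS ?leq_maxl ?leq_maxr.
Qed.

Lemma itrunc_iid n : itrunc n iid = 1%:M.
Proof. by apply/matrixP => i j; rewrite !mxE. Qed.

Lemma itriinv_lower L : lower_tri L -> nz_diag L ->
  lower_tri (itriinv L) /\ iinverse L (itriinv L).
Proof.
move=> Llow Lnz; have iLlow := itriinv_low Llow Lnz; split=> //.
split; apply: itrunc_inj => n; rewrite imul_trunc_lower// itriinv_trunc//.
- by rewrite mulmxV ?itrunc_iid ?itrunc_unit.
- by rewrite mulVmx ?itrunc_iid ?itrunc_unit.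
Qed.

Lemma imul_tr (A B : imatrix nat nat) :
  imul (itr A) (itr B) = itr (imul B A).
Proof.
apply/funext => i; apply/funext => j; rewrite /imul /itr.
by apply: eq_fsbigr => k _; rewrite mulrC.
Qed.

Lemma itriinv_upper U : upper_tri U -> nz_diag U ->
  upper_tri (itriinv U) /\ iinverse U (itriinv U).
Proof.
move=> Uup Unz; have Ulow : lower_tri (itr U) by move=> i j; exact: Uup.
have [Vlow [UV VU]] := itriinv_lower Ulow Unz.
rewrite itriinv_tr in Vlow UV VU; rewrite imul_tr in UV; rewrite imul_tr in VU.
have idT : itr iid = iid.
  by apply/funext => i; apply/funext => j; rewrite /itr /iid eq_sym.
split; first by move=> i j; exact: (Vlow j i).
by split; [rewrite -idT -VU|rewrite -idT -UV].
Qed.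

End Imatrix.

Arguments imatrix : clear implicits.
Arguments laurent : clear implicits.
Arguments Zmx {C} r _ _ _.

Section Moments.
Context {R : realType} {p q : nat}.
Variable mu : 'M[complex_measure (borel_circle R) R]_(q, p).

Definition left_moment : imatrix R[i] nat nat := fun i j =>
  \sum_(a < q) \sum_(b < p) complex_integral (mu a b) (fun t =>
    leval (Zmx q) (val t) i a * leval (ltr (Zmx p)) (val t)^-1 b j).

Definition right_moment : imatrix R[i] nat nat := fun i j =>
  \sum_(a < q) \sum_(b < p) complex_integral (mu a b) (fun t =>
    leval (Zmx q) (val t)^-1 i a * leval (ltr (Zmx p)) (val t) b j).

Definition left_gauss_borel (L U : imatrix R[i] nat nat) :=
  [/\ lower_tri L, nz_diag L, upper_tri U, nz_diag U &
      left_moment = imul (itriinv L) (itriinv (iconj U))].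

Definition right_gauss_borel (cL cU : imatrix R[i] nat nat) :=
  [/\ lower_tri cL, nz_diag cL, upper_tri cU, nz_diag cU &
      right_moment = imul (itriinv (iconj cL)) (itriinv cU)].

End Moments.

Section Szego.
Context {C : numClosedFieldType}.
Variable q : nat.

(* [lZ q L] is L Z_[q] (the families B and calligraphic A, for L and
   calligraphic L); [Zu p U] is Z_[p]^T U (the families A and calligraphic B,
   for U and calligraphic U). *)
Definition lZ (L : imatrix C nat nat) : laurent C nat 'I_q :=
  lmul_mx L (Zmx q).

Definition Zu (p : nat) (U : imatrix C nat nat) : laurent C 'I_p nat :=
  lmulr_mx (ltr (Zmx p)) U.

Variables L cL : imatrix C nat nat.

Definition szegoR := imul (imul (iconj cL) (eta_mx q)) (itriinv L).

Definition szego_calR := imul (imul L (eta_mx q)) (itriinv (iconj cL)).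

Definition szegoS := imul (imul L (nu_mx q)) (itriinv (iconj cL)).

Definition szego_calS := imul (imul (iconj cL) (nu_mx q)) (itriinv L).

End Szego.

Arguments lZ {C} q L _ _ _.
Arguments Zu {C} p U _ _ _.
Arguments szegoR {C} q L cL _ _.
Arguments szego_calR {C} q L cL _ _.
Arguments szegoS {C} q L cL _ _.
Arguments szego_calS {C} q L cL _ _.

(* Main.v *)
(** The matrix [Z_[r](z)] is mapped to a scalar multiple [c z] of [Z_[r](1/z)]
    by each of the two block permutations ([c = 1] for [eta], [c z = 1/z] for
    [nu]), which makes them intertwine the two moment matrices.  With the
    factorizations [M1 = L1^-1 U1^-1] and [M2 = L2^-1 U2^-1], the relation
    [s M1 = M2 s] becomes [L2 s L1^-1 = U2^-1 s U1].  The first form of this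
    matrix sends [L1 Z(z)] to [c z L2 Z(1/z)]; the second one, which after
    transposition has the same shape as the first, sends [Z(z)^T U2] to
    [c z Z(1/z)^T U1].  All the products are associative because the factors are
    row-finite or column-finite. *)
Require Import Defs.
From HB Require Import structures.
From mathcomp Require Import all_boot all_order all_algebra.
From mathcomp Require Import complex.
From mathcomp Require Import all_classical all_reals all_analysis.

Set Implicit Arguments.
Unset Strict Implicit.
Unset Printing Implicit Defensive.

Import Order.TTheory GRing.Theory Num.Theory.
Import numFieldNormedType.Exports.
Local Open Scope classical_set_scope.
Local Open Scope ring_scope.

(** * Products of infinite matrices with row-finite or column-finite factors *)

Section RowFinite.
Context {C : numClosedFieldType}.

Definition row_finite (I : Type) (A : imatrix C I nat) :=
  forall i, exists n, forall k, (n <= k)%N -> A i k = 0.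

Lemma imatrixP (I J : Type) (A B : imatrix C I J) :
  (forall i j, A i j = B i j) -> A = B.
Proof. by move=> AB; apply/funext => i; apply/funext. Qed.

Lemma lower_row_finite (A : imatrix C nat nat) : lower_tri A -> row_finite A.
Proof. by move=> Alow i; exists i.+1 => k; exact: Alow. Qed.

Lemma row_finite_mul (I : Type) (A : imatrix C I nat) (B : imatrix C nat nat) :
  row_finite A -> row_finite B -> row_finite (imul A B).
Proof.
move=> Afin /choice[m mB] i; have [n nA] := Afin i.
(* Row [i] of the product only involves the first [n] rows of [B], so the largest of their bounds
   works. *)
exists (\max_(k < n) m k)%N => l ml.
rewrite (@imulE _ _ _ _ _ _ _ n) => [|k nk]; last by rewrite nA ?mul0r.
apply: big1 => k _; rewrite mB ?mulr0//; apply: leq_trans ml.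
exact: (leq_bigmax k).
Qed.

(** Row [i] of [A] selects finitely many rows of [B], all vanishing from a common [N] on; both sides
    become finite double sums, whatever [D] is. *)
Lemma imulA_row_row (I J : Type) (A : imatrix C I nat) (B : imatrix C nat nat)
    (D : imatrix C nat J) :
  row_finite A -> row_finite B -> imul A (imul B D) = imul (imul A B) D.
Proof.
move=> Afin /choice[m mB]; apply: imatrixP => i j; have [n nA] := Afin i.
have AE J' (E : imatrix C nat J') l :
    imul A E i l = \sum_(k < n) A i k * E k l.
  by apply: imulE => k nk; rewrite nA ?mul0r.
set N := (\max_(k < n) m k)%N.
have BN (k : 'I_n) l : (N <= l)%N -> B k l = 0.
  by move=> Nl; apply: mB; apply: leq_trans Nl; exact: (leq_bigmax k).
rewrite AE (@imulE _ _ _ _ _ _ _ N) => [|l Nl]; last first.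
  by rewrite AE big1 ?mul0r// => k _; rewrite BN ?mulr0.
under [RHS]eq_bigr => l _ do rewrite AE mulr_suml.
rewrite exchange_big; apply: eq_bigr => k _ /=.
rewrite (@imulE _ _ _ _ _ _ _ N) => [|l Nl]; last by rewrite BN ?mul0r.
by rewrite mulr_sumr; apply: eq_bigr => l _; rewrite mulrA.
Qed.

(** The outer factors bound both summations, so [B] may be full, as a moment matrix is. *)
Lemma imulA_row_col (I J : Type) (A : imatrix C I nat) (B : imatrix C nat nat)
    (D : imatrix C nat J) :
  row_finite A -> row_finite (itr D) -> imul A (imul B D) = imul (imul A B) D.
Proof.
move=> Afin Dfin; apply: imatrixP => i j.
have [n nA] := Afin i; have [m mD] := Dfin j; rewrite /itr in mD.
rewrite (@imulE _ _ _ _ _ _ _ n) => [|k nk]; last by rewrite nA ?mul0r.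
rewrite [RHS](@imulE _ _ _ _ _ _ _ m) => [|k mk]; last by rewrite mD ?mulr0.
under eq_bigr => k _.
  rewrite (@imulE _ _ _ _ _ _ _ m) => [|l ml]; last by rewrite mD ?mulr0.
  rewrite mulr_sumr.
  over.
rewrite exchange_big; apply: eq_bigr => l _ /=.
rewrite (@imulE _ _ _ _ _ _ _ n) => [|k nk]; last by rewrite nA ?mul0r.
by rewrite mulr_suml; apply: eq_bigr => k _; rewrite mulrA.
Qed.

Lemma imul_itr (I J : Type) (A : imatrix C I nat) (B : imatrix C nat J) :
  itr (imul A B) = imul (itr B) (itr A).
Proof.
by apply: imatrixP => j i; apply: eq_fsbigr => k _; rewrite mulrC.
Qed.

Lemma imul_scale (I J : Type) c (A : imatrix C I nat) (B : imatrix C nat J) :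
  row_finite A -> imul A (iscale c B) = iscale c (imul A B).
Proof.
move=> Afin; apply: imatrixP => i j; have [n nA] := Afin i; rewrite /iscale.
rewrite (@imulE _ _ _ _ _ _ _ n) => [|k nk]; last by rewrite nA ?mul0r.
rewrite (@imulE _ _ _ _ _ _ _ n) => [|k nk]; last by rewrite nA ?mul0r.
by rewrite mulr_sumr; apply: eq_bigr => k _; rewrite mulrCA.
Qed.

Lemma imul_conj (I J : Type) (A : imatrix C I nat) (B : imatrix C nat J) :
  row_finite A -> iconj (imul A B) = imul (iconj A) (iconj B).
Proof.
move=> Afin; apply: imatrixP => i j; have [n nA] := Afin i; rewrite /iconj.
rewrite (@imulE _ _ _ _ _ _ _ n) => [|k nk]; last by rewrite nA ?mul0r.
rewrite (@imulE _ _ _ _ _ _ _ n) => [|k nk]; last by rewrite nA ?conjC0 ?mul0r.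
by rewrite rmorph_sum; apply: eq_bigr => k _; rewrite rmorphM.
Qed.

Lemma imul_iid (I : Type) (A : imatrix C I nat) : imul A iid = A.
Proof.
apply: imatrixP => i j; rewrite (@imulE _ _ _ _ _ _ _ j.+1) => [|k jk].
  rewrite big_ord_recr big1 => [|k _] /=.
    by rewrite /iid eqxx mulr1 add0r.
  by rewrite /iid ltn_eqF ?mulr0.
by rewrite /iid gtn_eqF ?mulr0.
Qed.

Lemma iid_imul (J : Type) (A : imatrix C nat J) : imul iid A = A.
Proof.
have idT : itr iid = iid :> imatrix C nat nat.
  by apply: imatrixP => i j; rewrite /itr /iid eq_sym.
by rewrite -[LHS]/(itr (itr (imul iid A))) imul_itr idT imul_iid.
Qed.

Lemma lower_conj (A : imatrix C nat nat) : lower_tri A -> lower_tri (iconj A).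
Proof. by move=> Alow i j ij; rewrite /iconj Alow ?conjC0. Qed.

Lemma upper_conj (A : imatrix C nat nat) : upper_tri A -> upper_tri (iconj A).
Proof. by move=> Aup i j ij; rewrite /iconj Aup ?conjC0. Qed.

Lemma nz_diag_conj (A : imatrix C nat nat) : nz_diag A -> nz_diag (iconj A).
Proof. by move=> Anz i; rewrite /iconj conjC_eq0. Qed.

End RowFinite.

(** * Block permutations acting on [Z_[r](z)] *)

Section Reflection.
Context {C : numClosedFieldType}.
Implicit Types (r : nat) (A L U : imatrix C nat nat) (z : C).

Definition perm_index r (s : nat -> nat) i := (s (i %/ r) * r + i %% r)%N.

Lemma perm_index_div r s i :
  (0 < r)%N -> (perm_index r s i %/ r)%N = s (i %/ r)%N.
Proof.
move=> r0; rewrite /perm_index divnMDl// [X in (_ + X)%N]divn_small ?addn0//.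
exact: ltn_pmod.
Qed.

Lemma perm_index_mod r s i : (perm_index r s i %% r = i %% r)%N.
Proof. by rewrite /perm_index modnMDl modn_mod. Qed.

Lemma block_permE r s i j :
  (0 < r)%N -> block_perm r s i j = (j == perm_index r s i)%:R :> C.
Proof.
move=> r0; rewrite /block_perm; congr (_%:R); congr nat_of_bool.
apply/andP/eqP => [[/eqP sij /eqP ij]|->].
  by rewrite {1}(divn_eq j r) -sij -ij.
by rewrite perm_index_div// perm_index_mod !eqxx.
Qed.

Lemma imul_block_perm (J : Type) r s (A : imatrix C nat J) i j :
  (0 < r)%N -> imul (block_perm r s) A i j = A (perm_index r s i) j.
Proof.
move=> r0; rewrite (@imulE _ _ _ _ _ _ _ (perm_index r s i).+1) => [|k ik].
  rewrite big_ord_recr big1 => [|k _] /=; rewrite block_permE//.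
    by rewrite eqxx mul1r add0r.
  by rewrite ltn_eqF ?mul0r.
by rewrite block_permE// gtn_eqF ?mul0r.
Qed.

Lemma block_perm_row_finite r s :
  (0 < r)%N -> row_finite (block_perm r s : imatrix C nat nat).
Proof.
move=> r0 i; exists (perm_index r s i).+1 => k ik.
by rewrite block_permE// gtn_eqF.
Qed.

Lemma block_perm_tr r s : involutive s ->
  itr (block_perm r s) = block_perm r s :> imatrix C nat nat.
Proof.
move=> sK; apply: imatrixP => i j; rewrite /itr /block_perm.
by rewrite (inv_eq sK) eq_sym [(j %% r == _)%N]eq_sym.
Qed.

Lemma imul_block_permr (I : Type) r s (A : imatrix C I nat) i j :
    (0 < r)%N -> involutive s ->
  imul A (block_perm r s) i j = A i (perm_index r s j).
Proof.
move=> r0 sK; rewrite -[LHS]/(itr (imul A (block_perm r s)) j i).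
by rewrite imul_itr block_perm_tr// imul_block_perm.
Qed.

(** Each row of [L] meets finitely many blocks, hence finitely many exponents, so the sums over rows
    and over exponents can be exchanged. *)
Lemma leval_lZ r L z : row_finite L ->
  leval (lZ r L) z = imul L (leval (Zmx r) z).
Proof.
move=> Lfin; apply: imatrixP => i a; have [n nL] := Lfin i.
(* The exponents occurring in the first [n] rows; [undup] is needed because the rows of a block
   share one exponent. *)
pose e := undup [seq block_exp (k %/ r) | k <- iota 0 n].
have LE J (X : imatrix C nat J) l : imul L X i l = \sum_(k < n) L i k * X k l.
  by apply: imulE => k nk; rewrite nL ?mul0r.
have Ze (k : 'I_n) d : d \notin e -> Zmx r d k a = 0 :> C.
  rewrite mem_undup => /mapP de; rewrite /Zmx; case: eqP => // dk.
  by case: de; exists (k : nat) => //; rewrite mem_iota add0n ltn_ord.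
rewrite LE /leval (fsbigE e) ?undup_uniq//; last first.
  move=> d _ /Ze Zd; rewrite /lZ /lmul_mx LE big1 ?mul0r// => k _.
  by rewrite Zd mulr0.
under [RHS]eq_bigr => k _.
  rewrite (fsbigE e) ?undup_uniq//; last by move=> d _ /Ze->; rewrite mul0r.
  rewrite mulr_sumr.
  over.
rewrite exchange_big; apply: eq_bigr => d _ /=.
by rewrite /lZ /lmul_mx LE mulr_suml; apply: eq_bigr => k _; rewrite mulrA.
Qed.

(** The coefficients of [Z_[r]] are 0 or 1, so conjugation only affects [L]. *)
Lemma lbar_lZ r L : row_finite L -> lbar (lZ r L) = lZ r (iconj L).
Proof.
move=> Lfin; apply/funext => d; rewrite /lbar /lZ /lmul_mx imul_conj//.
by congr imul; apply: imatrixP => i a; rewrite /iconj /Zmx conjC_nat.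
Qed.

Lemma Zu_tr r U : Zu r U = ltr (lZ r (itr U)).
Proof. by apply/funext => d; rewrite /ltr /lZ /lmul_mx imul_itr. Qed.

Lemma lbar_Zu r U : row_finite (itr U) -> lbar (Zu r U) = Zu r (iconj U).
Proof.
move=> Ufin; rewrite !Zu_tr -[RHS]/(ltr (lZ r (iconj (itr U)))).
by rewrite -lbar_lZ.
Qed.

(** The identity between the permuted [Z_[r](z)] and [c z] times [Z_[r](1/z)], read on the exponent
    of each block. *)
Definition reflects (s : nat -> nat) (c : C -> C) :=
  forall n z, z != 0 -> z ^ block_exp (s n) = c z * z^-1 ^ block_exp n.

Lemma leval_Zmx_perm r s c z i (a : 'I_r) : reflects s c -> z != 0 ->
  leval (Zmx r) z (perm_index r s i) a = c z * leval (Zmx r) z^-1 i a.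
Proof.
move=> sc z0; have r0 : (0 < r)%N by case: (r) a => [[]|].
rewrite !leval_Zmx perm_index_mod perm_index_div// sc//.
by case: ifP; rewrite ?mulr0.
Qed.

Lemma imul_perm_Zmx r s c z : reflects s c -> z != 0 -> (0 < r)%N ->
  imul (block_perm r s) (leval (Zmx r) z) = iscale (c z) (leval (Zmx r) z^-1).
Proof.
move=> sc z0 r0; apply: imatrixP => i a.
by rewrite imul_block_perm// (leval_Zmx_perm _ _ sc).
Qed.

Lemma eta_permK : involutive eta_perm.
Proof.
case=> [//|n]; rewrite {2}/eta_perm /=; have [|on] /= := boolP (odd n).
  by case: n => // n; rewrite /eta_perm /= => ->.
by rewrite /eta_perm /= negbK (negbTE on).
Qed.

Lemma nu_permK : involutive nu_perm.
Proof.
move=> n; rewrite {2}/nu_perm; have [|on] /= := boolP (odd n).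
  by case: n => // n; rewrite /nu_perm /= => /negbTE->.
by rewrite /nu_perm /= on.
Qed.

(** [eta_perm] negates the block exponent. *)
Lemma eta_reflects : reflects eta_perm (fun=> 1).
Proof.
move=> n z _; rewrite mul1r exprz_inv; congr (z ^ _).
case: n => [//|n]; rewrite /eta_perm /=; case: ifP => n0; rewrite /block_exp /=.
  by rewrite n0 /= uphalf_half (negPf n0) opprK.
by rewrite n0 (negbFE n0) uphalf_half (negbFE n0) add1n.
Qed.

(** [nu_perm] sends the block exponent [e] to [- e - 1]. *)
Lemma nu_reflects : reflects nu_perm (fun z => z^-1).
Proof.
move=> n z z0; rewrite exprz_inv -[z^-1]expr1z exprz_inv.
rewrite -expfzDr// /nu_perm; congr (z ^ _); case: ifP => n0.
  rewrite /block_exp n0; case: n n0 => //= n n0.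
  by rewrite (negPf n0) uphalf_half (negPf n0) opprK -addn1 PoszD addrC addrK.
by rewrite /block_exp /= n0 /= uphalf_half n0 -add1n PoszD opprD.
Qed.

(** * The recurrence for the families [L Z_[r]] *)

Section Intertwining.
Context {r : nat} {s : nat -> nat} {c : C -> C}.
Hypotheses (r0 : (0 < r)%N) (sc : reflects s c).

Lemma szego_left L1 L2 z : lower_tri L1 -> nz_diag L1 -> lower_tri L2 ->
    z != 0 ->
  imul (imul (imul L2 (block_perm r s)) (itriinv L1)) (leval (lZ r L1) z) =
  iscale (c z) (leval (lZ r L2) z^-1).
Proof.
move=> L1low L1nz L2low z0.
have [K1low [_ K1L1]] := itriinv_lower L1low L1nz.
have L1f := lower_row_finite L1low; have K1f := lower_row_finite K1low.
have L2f := lower_row_finite L2low.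
have sf := @block_perm_row_finite r s r0.
rewrite !leval_lZ// -imulA_row_row//; last exact: row_finite_mul.
(* The inverse of [L1] cancels [L1], leaving the permutation to act on [Z_[r](z)] itself. *)
rewrite (@imulA_row_row _ _ _ (itriinv L1) L1)// K1L1 iid_imul.
by rewrite -imulA_row_row// (imul_perm_Zmx sc)// imul_scale.
Qed.

End Intertwining.

(** * The two forms of the recurrence matrix, and the dual recurrence *)

Section Factorization.
Context {p q : nat} {s : nat -> nat} {c : C -> C}.
Hypotheses (p0 : (0 < p)%N) (q0 : (0 < q)%N).
Hypotheses (sK : involutive s) (sc : reflects s c).
Variables M1 M2 L1 L2 U1 U2 : imatrix C nat nat.
Hypotheses (L1low : lower_tri L1) (L1nz : nz_diag L1).
Hypotheses (L2low : lower_tri L2) (L2nz : nz_diag L2).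
Hypotheses (U1up : upper_tri U1) (U1nz : nz_diag U1).
Hypotheses (U2up : upper_tri U2) (U2nz : nz_diag U2).
Hypotheses (M1E : M1 = imul (itriinv L1) (itriinv U1)).
Hypotheses (M2E : M2 = imul (itriinv L2) (itriinv U2)).
Hypothesis sM : imul (block_perm q s) M1 = imul M2 (block_perm p s).

Local Notation X := (imul (imul L2 (block_perm q s)) (itriinv L1)).

Lemma szego_dual :
  itr X = imul (imul (itr U1) (block_perm p s)) (itriinv (itr U2)).
Proof.
have [K1low _] := itriinv_lower L1low L1nz.
have [K2low [L2K2 _]] := itriinv_lower L2low L2nz.
have [_ [_ N1U1]] := itriinv_upper U1up U1nz.
have K1f := lower_row_finite K1low; have K2f := lower_row_finite K2low.
have L2f := lower_row_finite L2low.
have U1f : row_finite (itr U1) by apply: lower_row_finite => i j; exact: U1up.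
have pf := @block_perm_row_finite p s p0.
have qf := @block_perm_row_finite q s q0.
have -> : X = imul (imul (itriinv U2) (block_perm p s)) U1.
  have L2s := row_finite_mul L2f qf.
  (* Inserting [U1^-1 U1] after [L1^-1] makes [M1 U1] appear; then [s M1 = M2 s], and [L2] cancels
     the left factor of [M2]. *)
  rewrite -[itriinv L1]imul_iid -N1U1.
  rewrite (@imulA_row_col _ _ _ _ (itriinv U1) U1)//.
  rewrite -M1E imulA_row_col//; congr (imul _ U1).
  rewrite -imulA_row_row// sM imulA_row_col ?block_perm_tr//.
  by rewrite M2E imulA_row_row// L2K2 iid_imul.
by rewrite !imul_itr block_perm_tr// -itriinv_tr imulA_row_row.
Qed.

Lemma szego_relations z : z != 0 ->
  imul X (leval (lZ q L1) z) = iscale (c z) (leval (lZ q L2) z^-1) /\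
  imul (leval (Zu p U2) z) X = iscale (c z) (leval (Zu p U1) z^-1).
Proof.
move=> z0; split; first exact: szego_left.
have tr_inj : injective (@itr C 'I_p nat).
  by move=> A B AB; rewrite -[A]/(itr (itr A)) AB.
apply: tr_inj; rewrite imul_itr szego_dual !Zu_tr.
(* The transposes of [U2] and [U1] are lower triangular and take the places of [L1] and [L2]. *)
apply: (szego_left p0 sc) => // i j; [exact: U2up|exact: U1up].
Qed.

End Factorization.
End Reflection.

(** * Block permutations exchange the two moment matrices *)

Section Moment.
Context {R : realType} {p q : nat}.
Variable mu : 'M[complex_measure (borel_circle R) R]_(q, p).

(* The moment matrix of the circle reparametrized by [w]: the left one for
   [w = id] and the right one for [w = inverse]. *)
Definition moment_along (w : circle R -> R[i]) : imatrix R[i] nat nat :=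
  fun i j => \sum_(a < q) \sum_(b < p) complex_integral (mu a b) (fun t =>
    leval (Zmx q) (w t) i a * leval (ltr (Zmx p)) (w t)^-1 b j).

(** Permuting rows on the left and columns on the right turns both integrands into [c (w t)] times
    the same product of entries at [1/w t]; the factor depends on [t], so the comparison is made
    under the integral. *)
Lemma moment_along_perm w s (c : R[i] -> R[i]) :
    (0 < p)%N -> (0 < q)%N -> involutive s -> reflects s c ->
    (forall t, w t != 0) ->
  imul (block_perm q s) (moment_along w) =
  imul (moment_along (fun t => (w t)^-1)) (block_perm p s).
Proof.
move=> p0 q0 sK sc w0; apply: imatrixP => i j.
rewrite (imul_block_perm _ _ _ _ q0) (imul_block_permr _ _ _ p0 sK).
apply: eq_bigr => a _; apply: eq_bigr => b _.
apply: (congr1 (complex_integral _)); apply/funext => t.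
have levalT z k : leval (ltr (Zmx p)) z b k = leval (Zmx p) z k b by [].
rewrite !levalT invrK !(leval_Zmx_perm _ _ sc)//.
by rewrite mulrCA mulrA.
Qed.

Lemma circle_neq0 (t : circle R) : val t != 0.
Proof. by rewrite -normr_eq0 (eqP (valP t)) oner_eq0. Qed.

Lemma left_right_moment s (c : R[i] -> R[i]) :
    (0 < p)%N -> (0 < q)%N -> involutive s -> reflects s c ->
  imul (block_perm q s) (left_moment mu) =
    imul (right_moment mu) (block_perm p s) /\
  imul (block_perm q s) (right_moment mu) =
    imul (left_moment mu) (block_perm p s).
Proof.
move=> p0 q0 sK sc.
have rightE : right_moment mu = moment_along (fun t => (val t)^-1).
  apply: imatrixP => i j; apply: eq_bigr => a _; apply: eq_bigr => b _.
  by apply: (congr1 (complex_integral _)); apply/funext => t; rewrite invrK.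
(* The double inverse matches the right-hand side of [moment_along_perm] when [w] is the inverse. *)
have leftE : left_moment mu = moment_along (fun t => (val t)^-1^-1).
  apply: imatrixP => i j; apply: eq_bigr => a _; apply: eq_bigr => b _.
  by apply: (congr1 (complex_integral _)); apply/funext => t; rewrite invrK.
have w0 t : (val t : R[i]) != 0 := @circle_neq0 t.
have iw0 t : (val (t : circle R))^-1 != 0 by rewrite invr_eq0.
split; last by rewrite rightE leftE; exact: (moment_along_perm p0 q0 sK sc iw0).
by rewrite rightE; exact: (moment_along_perm p0 q0 sK sc w0).
Qed.

End Moment.

Theorem proposition2p35 (R : realType) (p q : nat)
    (hp : (0 < p)%N) (hq : (0 < q)%N)
    (mu : 'M[complex_measure (borel_circle R) R]_(q, p))
    (hmu : forall a b, infinite_set (measure_support (mu a b)))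
    (L U cL cU : imatrix R[i] nat nat)
    (hM : left_gauss_borel mu L U)
    (hcM : right_gauss_borel mu cL cU) :
  let B := lZ q L in
  let A := Zu p U in
  let cA := lZ q cL in
  let cB := Zu p cU in
  let rR := szegoR q L cL in
  let crR := szego_calR q L cL in
  let rS := szegoS q L cL in
  let crS := szego_calS q L cL in
  forall z : R[i], z != 0 ->
    (imul rR (leval B z) = leval (lbar cA) z^-1 /\
     imul (leval cB z) rR = leval (lbar A) z^-1 /\
     imul crR (leval (lbar cA) z) = leval B z^-1 /\
     imul (leval (lbar A) z) crR = leval cB z^-1) /\
    (imul rS (leval (lbar cA) z^-1) = iscale z (leval B z) /\
     imul (leval (lbar A) z^-1) rS = iscale z (leval cB z) /\
     imul crS (leval B z^-1) = iscale z (leval (lbar cA) z) /\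
     imul (leval cB z^-1) crS = iscale z (leval (lbar A) z)).
Proof.
move=> B A cA cB rR crR rS crS z z0.
have iz0 : z^-1 != 0 by rewrite invr_eq0.
have [Llow Lnz Uup Unz ME] := hM; have [cLlow cLnz cUup cUnz cME] := hcM.
have scale1 (I J : Type) (P : imatrix R[i] I J) : iscale 1 P = P.
  by apply: imatrixP => i j; rewrite /iscale mul1r.
have cLf := lower_row_finite cLlow.
have Uf : row_finite (itr U) by apply: lower_row_finite => i j; exact: Uup.
(* The factorizations involve the conjugates of [cL] and [U], which also carry the barred
   families. *)
have cL'low := lower_conj cLlow; have cL'nz := nz_diag_conj cLnz.
have U'up := upper_conj Uup; have U'nz := nz_diag_conj Unz.
rewrite {}/cA {}/A lbar_lZ// lbar_Zu//.
have [etaM etacM] := left_right_moment mu hp hq eta_permK eta_reflects.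
have [nuM nucM] := left_right_moment mu hp hq nu_permK nu_reflects.
have [R1 R2] := szego_relations hp hq eta_permK eta_reflects
  Llow Lnz cL'low cL'nz U'up U'nz cUup cUnz ME cME etaM z0.
(* Exchanging the roles of the two moment matrices gives the relations for [crR]. *)
have [cR1 cR2] := szego_relations hp hq eta_permK eta_reflects
  cL'low cL'nz Llow Lnz cUup cUnz U'up U'nz cME ME etacM z0.
(* For [nu] the evaluation is at [z^-1], where the factor [c] equals [z]. *)
have [S1 S2] := szego_relations hp hq nu_permK nu_reflects
  cL'low cL'nz Llow Lnz cUup cUnz U'up U'nz cME ME nucM iz0.
have [cS1 cS2] := szego_relations hp hq nu_permK nu_reflects
  Llow Lnz cL'low cL'nz U'up U'nz cUup cUnz ME cME nuM iz0.
rewrite !scale1 in R1 R2 cR1 cR2; rewrite !invrK in S1 S2 cS1 cS2.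
by do !split.
Qed.
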